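(* Let $X\sim N_d(\theta,\sigma_X^2 I_d)$ and $Y\sim N_d(\theta,\sigma_Y^2 I_d)$ be independent, with $\theta\in C\subset\mathbb{R}^d$, and consider the problem of estimating the density of $Y$ on the basis of $X$ under $\alpha$-divergence loss $L_\alpha$ with $|\alpha|<1$. Let $\hat\theta(X)$ be a non-degenerate estimator of $\theta$, and for $c\ge1$ let $q_{\hat\theta,c}(\cdot;X)$ be the density of $N_d(\hat\theta(X),c^2\sigma_Y^2I_d)$. With $Z=\frac{\|\hat\theta(X)-\theta\|^2}{\sigma_Y^2}$, assume that $$\epsilon=\inf_{\theta\in C}\mathbb{E}_\theta\left(Z\,e^{-(1-\alpha^2)Z/8}\right)>0.$$ Suppose that the predictive density $q_{\hat\theta,c}$ dominates $q_{\hat\theta,1}$ for $c\in(1,k^* )$ under loss $L_\alpha$. Let $F$ be a cumulative distribution function such that $F(1)=0$ and $F(k^* )=1$. Then the mixture density $$\hat q_F(y;X)=\int_1^{k^*}q_{\hat\theta,z}(y;X)\,dF(z)$$ also dominates $q_{\hat\theta,1}$ under loss $L_\alpha$.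
   Context: Let $q(\cdot|\theta)$ be the density of $N_d(\theta,\sigma_Y^2 I_d)$. For $|\alpha|<1$ let $h_\alpha(z)=\frac{4}{1-\alpha^2}\left(1-z^{(1+\alpha)/2}\right)$. The $\alpha$-divergence loss of a predictive density $\hat q(\cdot;x)$ is $L_\alpha(\theta,\hat q(\cdot;x))=\int_{\mathbb{R}^d}h_\alpha\!\left(\frac{\hat q(y;x)}{q(y|\theta)}\right)q(y|\theta)\,dy$, and its frequentist risk is $R_\alpha(\theta,\hat q)=\mathbb{E}_\theta[L_\alpha(\theta,\hat q(\cdot;X))]$, where $\mathbb{E}_\theta$ is the expectation over $X\sim N_d(\theta,\sigma_X^2I_d)$. A predictive density $\hat q_1$ dominates $\hat q_2$ if $R_\alpha(\theta,\hat q_1)\le R_\alpha(\theta,\hat q_2)$ for all $\theta\in C$, with strict inequality for at least one $\theta\in C$. An estimator $\hat\theta(X)$ is non-degenerate if it is not almost surely constant.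
   Formalization: The formal theorem additionally assumes that F is not the point mass at k*; in that case the mixture is the density with c = k*, which need not dominate strictly, so the statement fails as written. *)

(* Defs.v *)
From HB Require Import structures.
From mathcomp Require Import all_boot all_order all_algebra.
From mathcomp Require Import all_classical all_reals all_analysis.

Set Implicit Arguments.
Unset Strict Implicit.
Unset Printing Implicit Defensive.
Import Order.TTheory GRing.Theory Num.Theory.
Import numFieldNormedType.Exports.
Local Open Scope classical_set_scope.
Local Open Scope ring_scope.

(* R^d, with the product sigma-algebra that the library puts on tuples. *)
Notation Rvec R d := (d.-tuple (measurableTypeR R)).

Section lebesgue_measure_on_Rvec.
Context {R : realType}.

Definition Rvec_cons n (p : measurableTypeR R * Rvec R n) : Rvec R n.+1 :=
  [tuple of p.1 :: p.2].

Lemma measurable_Rvec_cons n : measurable_fun [set: _] (@Rvec_cons n).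
Proof. exact: measurable_cons. Qed.

Section step.
Context n (mu : {sigma_finite_measure set (Rvec R n) -> \bar R}).

Definition lebesgue_step : set (Rvec R n.+1) -> \bar R :=
  pushforward (@lebesgue_measure R \x mu)%E (@Rvec_cons n).

Let mcons := @measurable_Rvec_cons n.

Let lebesgue_step0 : lebesgue_step set0 = 0%E.
Proof. exact: measure0. Qed.

Let lebesgue_step_ge0 A : (0 <= lebesgue_step A)%E.
Proof. exact: measure_ge0. Qed.

Let lebesgue_step_sigma_additive : semi_sigma_additive lebesgue_step.
Proof. exact: measure_semi_sigma_additive. Qed.

HB.instance Definition _ := isMeasure.Build _ _ _ lebesgue_step
  lebesgue_step0 lebesgue_step_ge0 lebesgue_step_sigma_additive.

Let lebesgue_step_sigma_finite : sigma_finite [set: _] lebesgue_step.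
Proof.
have /sigma_finiteP[F [FT ndF Foo]] := sigma_finiteT (@lebesgue_measure R).
have /sigma_finiteP[G [GT ndG Goo]] := sigma_finiteT mu.
pose tl (t : Rvec R n.+1) : Rvec R n := [tuple of behead t].
pose FG k : set (Rvec R n.+1) := (fun t => thead t) @^-1` F k `&` tl @^-1` G k.
have consK x (t : Rvec R n) : tl (Rvec_cons (x, t)) = t by exact/val_inj.
have FGE k : @Rvec_cons n @^-1` FG k = F k `*` G k.
  apply/seteqP; split=> -[x t]; by rewrite /FG /= consK.
exists FG.
  apply/esym/seteqP; split=> // t _.
  have [i _ Fi] : (\bigcup_i F i) (thead t) by rewrite -FT.
  have [j _ Gj] : (\bigcup_i G i) (tl t) by rewrite -GT.
  exists (maxn i j) => //; split=> /=.
    by move: Fi; exact/subsetPset/ndF/leq_maxl.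
  by move: Gj; exact/subsetPset/ndG/leq_maxr.
move=> k; have [mF Fk] := Foo k; have [mG Gk] := Goo k; split.
  apply: measurableI; rewrite -[X in measurable X]setTI.
    exact: (measurable_tnth ord0).
  exact: measurable_behead.
rewrite /lebesgue_step /pushforward FGE product_measure1E//.
by rewrite lte_mul_pinfty// ge0_fin_numE.
Qed.

HB.instance Definition _ := Measure_isSigmaFinite.Build _ _ _ lebesgue_step
  lebesgue_step_sigma_finite.

End step.

Fixpoint lebesgue_Rvec n : {sigma_finite_measure set (Rvec R n) -> \bar R} :=
  match n with
  | 0 => dirac ([tuple] : Rvec R 0)
  | m.+1 => lebesgue_step (lebesgue_Rvec m)
  end.

Lemma lebesgue_RvecE n (A : 'I_n -> set (measurableTypeR R)) :
  (forall i, measurable (A i)) ->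
  lebesgue_Rvec n [set t | forall i, A i (tnth t i)] =
  (\prod_(i < n) lebesgue_measure (A i))%E.
Proof.
elim: n A => [|n IHn] A mA.
  rewrite big_ord0 /= (_ : [set _ | _] = setT) ?diracT//.
  by apply/seteqP; split=> // t _ [].
rewrite big_ord_recl -IHn//= /lebesgue_step /pushforward -product_measure1E//=.
  congr (_ _); apply/seteqP; split=> [[x t] /= At|[x t] /= [Ax At] i].
    by split=> [|i]; [exact: (At ord0)|have := At (lift ord0 i); rewrite tnthS].
  by case: (unliftP ord0 i) => [j|] ->; rewrite ?tnthS.
rewrite (_ : [set _ | _] = \bigcap_i (fun t : Rvec R n => tnth t i) @^-1` A (lift ord0 i)).
  apply: fin_bigcap_measurable => // i _.
  by rewrite -[X in measurable X]setTI; exact: measurable_tnth.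
by apply/seteqP; split=> t /= At i; [move=> _|]; exact: At.
Qed.

End lebesgue_measure_on_Rvec.

Section prediction.
Context {R : realType} {n : nat}.
Implicit Types (theta x y : Rvec R n) (s alpha : R).

Definition sqdist x y : R := \sum_(i < n) (tnth x i - tnth y i : R) ^+ 2.

(* Density of N_n(theta, s^2 I_n) : (2 pi s^2)^(-n/2) exp (-|y-theta|^2/(2s^2)) *)
Definition mvnormal_pdf theta s y : R :=
  normal_peak s ^+ n * expR (- sqdist y theta / (s ^+ 2 *+ 2)).

(* N_n(theta, s^2 I_n) *)
Definition mvnormal theta s (A : set (Rvec R n)) : \bar R :=
  (\int[lebesgue_Rvec n]_(y in A) (mvnormal_pdf theta s y)%:E)%E.

Definition h_div alpha (z : R) : R :=
  4 / (1 - alpha ^+ 2) * (1 - z `^ ((1 + alpha) / 2)).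

(* A predictive density is a function of the observation x and of the point y,
   in that order. *)
Definition alpha_loss alpha sY theta (q : Rvec R n -> R) : \bar R :=
  (\int[lebesgue_Rvec n]_y
     (h_div alpha (q y / mvnormal_pdf theta sY y) * mvnormal_pdf theta sY y)%:E)%E.

Section model.
Context {dT : measure_display} {T : measurableType dT}.
Context (P : Rvec R n -> probability T R) (X : T -> Rvec R n).

Definition alpha_risk alpha sY (q : Rvec R n -> Rvec R n -> R) theta : \bar R :=
  (\int[P theta]_w alpha_loss alpha sY theta (q (X w)))%E.

Definition dominates (C : set (Rvec R n)) alpha sY
    (q1 q2 : Rvec R n -> Rvec R n -> R) : Prop :=
  (forall theta, C theta ->
     (alpha_risk alpha sY q1 theta <= alpha_risk alpha sY q2 theta)%E) /\
  (exists2 theta, C theta &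
     (alpha_risk alpha sY q1 theta < alpha_risk alpha sY q2 theta)%E).

(* The P_theta, theta in C, are expected to make X normally distributed with
   mean theta, so that they all have the same null events for X. *)
Definition non_degenerate (C : set (Rvec R n)) (est : Rvec R n -> Rvec R n) :=
  forall theta, C theta ->
    ~ exists t, {ae P theta, forall w, est (X w) = t}.

End model.

Definition independent_RV2 {dT : measure_display} {T : measurableType dT}
    (Q : probability T R) (X Y : T -> Rvec R n) : Prop :=
  forall A B, measurable A -> measurable B ->
    Q (X @^-1` A `&` Y @^-1` B) = (Q (X @^-1` A) * Q (Y @^-1` B))%E.

Definition plugin_density (est : Rvec R n -> Rvec R n) sY (c : R) :
    Rvec R n -> Rvec R n -> R :=
  fun x y => mvnormal_pdf (est x) (c * sY) y.

Definition mixture_density (est : Rvec R n -> Rvec R n) sY (k : R)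
    (F : cumulativeBounded (0 : R) (1 : R)) : Rvec R n -> Rvec R n -> R :=
  fun x y => \int[lebesgue_stieltjes_measure F]_(z in `[1, k])
    plugin_density est sY z x y.

End prediction.

(* Main.v *)
Require Import Defs.
From HB Require Import structures.
From mathcomp Require Import all_boot all_order all_algebra.
From mathcomp Require Import all_classical all_reals all_analysis.
From mathcomp Require Import measurable_realfun ring lra.
Import Order.TTheory GRing.Theory Num.Theory.
Import numFieldNormedType.Exports.
Local Open Scope classical_set_scope.
Local Open Scope ring_scope.

(** For alpha-divergence the loss of a predictive density [q] is
<<K * (1 - A(q))>>, where [K > 0] and [A(q)] is the integral of
<<q ^ b * p ^ (1 - b)>>, with [b = (1 + alpha) / 2] and [p] the true density.
Averaging over the observation gives the risk, so that [q] dominates [q']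
exactly when the mean affinity of [q] with the truth is at least that of [q'],
with a strict inequality somewhere ([dominates_affinity]).

The power [t `^ b] is concave. Jensen's inequality and Tonelli's theorem thus
bound the mean affinity of the mixture from below by the average, over the
mixing distribution, of the mean affinities of the plug-in densities
([mean_affinity_mixture]). Below [k] these are by assumption at least the one
of the scale [1].

Two points remain, and both rest on the inequality
[(c / c') ^+ n * q_c <= q_c'] for [c <= c'] ([scaled_mvnormal_pdf_le]), which
passes to the mean affinities.
- The mixing distribution may charge [k], where nothing is assumed. Letting [c]
  increase to [k] extends the comparison to that scale
  ([plugin_affinity_ge_clamp]).
- The parameter at which the inequality is strict may change with the scale, so
  that one parameter has to serve a set of scales of positive mass. Choose a
  scale [c] in ]1, k[ of which every right neighbourhood has positive mass
  ([interior_support_point]; it exists because the distribution is not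
  concentrated at [k]), and the parameter that belongs to [c]. The strict
  inequality at [c] extends to a right neighbourhood of [c], and this makes the
  average strictly larger ([mixture_affinity_gt_plugin]). *)

Set Implicit Arguments.
Unset Strict Implicit.
Unset Printing Implicit Defensive.

(** * Normal densities on R^n *)

(** With the convention [0^-1 = 0], the identity [x^-1 = x * (x ^+ 2) `^ (-1)] holds
at every real [x], and real powers are measurable on the whole line. *)
Lemma measurable_funV (R : realType) d (U : measurableType d) (f : U -> R) :
  measurable_fun setT f -> measurable_fun setT (fun u => (f u)^-1).
Proof.
move=> mf; rewrite (_ : (fun u => _) = fun u => f u * (f u ^+ 2) `^ (- 1)).
  apply: measurable_funM => //.
  apply: (measurableT_comp (@measurable_powR R (-1))).
  exact: measurable_funX.
apply/funext => u; have [->|fu0] := eqVneq (f u) 0.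
  by rewrite invr0 mul0r.
by rewrite powR_inv1 ?sqr_ge0// expr2 invfM mulrA divff// mul1r.
Qed.

Section normal.
Context {R : realType}.

Lemma mvnormal_pdf_gt0 n (theta : Rvec R n) (s : R) y :
  0 < s -> 0 < mvnormal_pdf theta s y.
Proof.
by move=> s0; rewrite mulr_gt0 ?expR_gt0// exprn_gt0// normal_peak_gt0// gt_eqF.
Qed.

Lemma measurable_mvnormal_pdf d (U : measurableType d) n
    (f g : U -> Rvec R n) (s : U -> R) :
  measurable_fun setT f -> measurable_fun setT s -> measurable_fun setT g ->
  measurable_fun setT (fun u => mvnormal_pdf (f u) (s u) (g u)).
Proof.
move=> mf ms mg; rewrite /mvnormal_pdf.
have ms2 : measurable_fun setT (fun u => s u ^+ 2) by exact: measurable_funX.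
apply: measurable_funM.
  apply: measurable_funX; apply: measurable_funV.
  have mpi : measurable_fun setT (fun u => s u ^+ 2 * pi *+ 2).
    under eq_fun do rewrite -mulrnAr.
    exact: measurable_funM.
  exact: (measurableT_comp (continuous_measurable_fun (@sqrt_continuous R)) mpi).
apply: (measurableT_comp (@measurable_expR R)); apply: measurable_funM.
  apply: measurable_funN; apply: measurable_sum => i.
  apply: measurable_funX; apply: measurable_funB.
    exact: (measurableT_comp (measurable_tnth i)).
  exact: (measurableT_comp (measurable_tnth i)).
apply: measurable_funV; under eq_fun do rewrite -mulr_natr.
exact: measurable_funM.
Qed.

Lemma ge0_integral_lebesgue_RvecS n (f : Rvec R n.+1 -> \bar R) :
  measurable_fun setT f -> (forall t, 0 <= f t)%E ->
  (\int[lebesgue_Rvec n.+1]_t f t =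
   \int[lebesgue_measure]_x \int[lebesgue_Rvec n]_t f (Rvec_cons (x, t)))%E.
Proof.
move=> mf f0.
rewrite [LHS](ge0_integral_pushforward (@measurable_Rvec_cons R n))//.
rewrite preimage_setT fubini_tonelli1//.
  by apply: measurableT_comp => //; exact: measurable_Rvec_cons.
by move=> x; exact: f0.
Qed.

(** The coordinates of a spherical normal vector are independent: the density
splits off its first factor. With Tonelli this reduces every normal integral
over R^(n+1) to one over R^n. *)
Lemma mvnormal_pdf_cons n (theta : Rvec R n.+1) (s : R) x (t : Rvec R n) :
  s != 0 -> mvnormal_pdf theta s (Rvec_cons (x, t)) =
  normal_pdf (thead theta) s x * mvnormal_pdf [tuple of behead theta] s t.
Proof.
move=> s0; rewrite normal_pdfE// /mvnormal_pdf /normal_fun exprS.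
rewrite -!mulrA; congr (_ * _); rewrite mulrCA; congr (_ * _).
rewrite -expRD; congr expR; rewrite -mulrDl.
congr (_ * _); rewrite -opprD; congr (- _).
rewrite /sqdist big_ord_recl; congr (_ + _).
apply: eq_bigr => i _; congr ((_ - _) ^+ 2); rewrite ?tnthS//.
by rewrite tnth_behead; congr tnth; apply/val_inj; rewrite /= inordK// ltnS.
Qed.

Lemma integral_mvnormal_pdf n (theta : Rvec R n) (s : R) : 0 < s ->
  (\int[lebesgue_Rvec n]_y (mvnormal_pdf theta s y)%:E = 1)%E.
Proof.
move=> s_gt0; have s0 : s != 0 by rewrite gt_eqF.
have mpdf m (th : Rvec R m) : measurable_fun setT (fun y => (mvnormal_pdf th s y)%:E).
  by apply/measurable_EFinP; exact: measurable_mvnormal_pdf.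
elim: n theta => [|n IHn] theta.
  rewrite integral_dirac//; first rewrite diracE in_setT mul1e /mvnormal_pdf expr0 mul1r.
    by rewrite /sqdist big_ord0 oppr0 mul0r expR0.
  exact: mpdf.
rewrite (ge0_integral_lebesgue_RvecS (mpdf n.+1 theta)); last first.
  by move=> t; rewrite lee_fin ltW// mvnormal_pdf_gt0.
rewrite -(integral_normal_pdf (thead theta) s); apply: eq_integral => x _.
under eq_integral do rewrite mvnormal_pdf_cons// EFinM.
rewrite ge0_integralZl_EFin ?normal_pdf_ge0//.
- by rewrite IHn mule1.
- by move=> t _; rewrite lee_fin ltW// mvnormal_pdf_gt0.
- exact: mpdf.
Qed.

(** The factor [(c / c') ^+ n] compensates the ratio of the two normalising
constants, and the exponential increases with the scale. This one-sided bound
takes the place of the continuity of the risk in the scale. *)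
Lemma scaled_mvnormal_pdf_le n (theta y : Rvec R n) (s c c' : R) :
  0 < s -> 0 < c <= c' ->
  (c / c') ^+ n * mvnormal_pdf theta (c * s) y <= mvnormal_pdf theta (c' * s) y.
Proof.
move=> s0 /andP[c0 cc']; have c'0 : 0 < c' by exact: lt_le_trans cc'.
have peakZ a : 0 < a -> normal_peak (a * s) = normal_peak s / a.
  move=> a0; rewrite /normal_peak exprMn -mulrA -mulrnAr sqrtrM ?sqr_ge0//.
  by rewrite sqrtr_sqr gtr0_norm// invfM mulrC.
rewrite /mvnormal_pdf !peakZ// mulrA -exprMn.
rewrite (_ : c / c' * _ = normal_peak s / c'); last first.
  by rewrite mulrC mulrA divfK ?gt_eqF//.
apply: ler_wpM2l.
  by rewrite exprn_ge0// divr_ge0 ?normal_peak_ge0// ltW.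
rewrite ler_expR !mulNr lerN2; apply: ler_wpM2l.
  by apply: sumr_ge0 => i _; exact: sqr_ge0.
rewrite lef_pV2 ?posrE ?pmulrn_rgt0 ?exprn_gt0 ?mulr_gt0//.
by rewrite lerMn2r/= lerXn2r ?nnegrE ?mulr_ge0 ?ler_wpM2r// ltW.
Qed.

End normal.

(** * Weighted affinity between densities *)

Lemma integral_probability_cst d (S : measurableType d) (R : realType)
    (mu : probability S R) (x : \bar R) : (\int[mu]_s x = x)%E.
Proof.
transitivity (x * mu setT)%E; first exact: integral_cst.
by rewrite probability_setT mule1.
Qed.

(** The tangent line at [a] of the concave function [t `^ b], obtained from
Young's inequality for [(t / a) `^ b] and [1]. *)
Lemma powR_tangent (R : realType) (b a t : R) : 0 < b < 1 -> 0 < a -> 0 <= t ->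
  t `^ b <= a `^ b * (b * (t / a) + (1 - b)).
Proof.
move=> /andP[b0 b1] a0 t0; have b'0 : 0 < 1 - b by rewrite subr_gt0.
have ta0 : 0 <= t / a by rewrite divr_ge0// ltW.
have -> : t `^ b = a `^ b * (t / a) `^ b.
  by rewrite -powRM ?(ltW a0)// mulrC divfK ?gt_eqF.
apply: ler_wpM2l; first exact: powR_ge0.
have := @conjugate_powR R ((t / a) `^ b) 1 b^-1 (1 - b)^-1.
rewrite mulr1 powR1 -powRrM mulfV ?gt_eqF// powRr1// !invrK mul1r (mulrC (t / a)).
apply; rewrite ?powR_ge0 ?invr_gt0//; ring.
Qed.

Section affinity.
Context {R : realType} {dY} {Y : measurableType dY}.
Variables (lambda : {sigma_finite_measure set Y -> \bar R}) (b : R) (p : Y -> R).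
Hypotheses (b01 : 0 < b < 1) (mp : measurable_fun setT p).
Hypotheses (p_gt0 : forall y, 0 < p y) (ip : (\int[lambda]_y (p y)%:E = 1)%E).

(** The weighted geometric mean [q ^ b * p ^ (1 - b)], written so that its factor
[(q / p) ^ b] is the power that occurs in the alpha-divergence. *)
Definition wgeom (q : Y -> R) (y : Y) : R := (q y / p y) `^ b * p y.

(** The affinity (Chernoff coefficient) of order [b] of [p] and [q]. *)
Definition affinity (q : Y -> R) : \bar R := (\int[lambda]_y (wgeom q y)%:E)%E.

Lemma wgeom_ge0 q y : 0 <= wgeom q y.
Proof. by rewrite mulr_ge0 ?powR_ge0// ltW. Qed.

Lemma affinity_ge0 q : (0 <= affinity q)%E.
Proof. by apply: integral_ge0 => y _; rewrite lee_fin wgeom_ge0. Qed.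

Lemma measurable_wgeom d (U : measurableType d) (q : U -> Y -> R) (f : U -> Y) :
  measurable_fun setT f -> measurable_fun setT (fun u => q u (f u)) ->
  measurable_fun setT (fun u => wgeom (q u) (f u)).
Proof.
move=> mf mq; have mpf : measurable_fun setT (p \o f) by exact: measurableT_comp.
apply: measurable_funM => //.
apply: (measurableT_comp (@measurable_powR R b)).
by apply: measurable_funM => //; exact: measurable_funV.
Qed.

Lemma wgeom_le q y : 0 <= q y -> wgeom q y <= q y + p y.
Proof.
move=> q0; have /andP[b0 b1] := b01; have py := p_gt0 y.
have := powR_tangent b01 ltr01 (divr_ge0 q0 (ltW py)).
rewrite powR1 mul1r divr1 => h.
apply: (le_trans (ler_wpM2r (ltW py) h)).
rewrite mulrDl -mulrA divfK ?gt_eqF//; apply: lerD.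
  by rewrite ler_piMl// ltW.
by rewrite ler_piMl ?(ltW py)// lerBlDr lerDl ltW.
Qed.

(** The tangent line at [1] bounds [q ^ b * p ^ (1 - b)] by [q + p]; this is what
makes all the losses and risks below finite. *)
Lemma affinity_le (q : Y -> R) (M : R) : measurable_fun setT q -> (forall y, 0 <= q y) ->
  (\int[lambda]_y (q y)%:E <= M%:E)%E -> (affinity q <= (M + 1)%:E)%E.
Proof.
move=> mq q0 qM; rewrite EFinD -ip.
apply: (le_trans _ (leeD qM (lexx _))); rewrite -ge0_integralD//; first last.
- exact/measurable_EFinP.
- by move=> y _; rewrite lee_fin ltW.
- exact/measurable_EFinP.
- by move=> y _; rewrite lee_fin.
rewrite /affinity; apply: ge0_le_integral => //.
- by move=> y _; rewrite lee_fin wgeom_ge0.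
- apply/measurable_EFinP; exact: (@measurable_wgeom _ _ (fun=> q)).
- by apply: emeasurable_funD; exact/measurable_EFinP.
- by move=> y _; rewrite -EFinD lee_fin wgeom_le.
Qed.

Section average.
Context {dT} {T : measurableType dT} (P : probability T R).
Implicit Type q : T -> Y -> R.

Definition mean_affinity q : \bar R := (\int[P]_w affinity (q w))%E.

(** A bound on the total mass passes to a mixture by pointwise comparison, whereas
total mass one would require a further interchange of integrals. *)
Definition mass_bounded q : Prop :=
  [/\ measurable_fun setT (fun z : T * Y => q z.1 z.2),
      forall w y, 0 <= q w y &
      exists M : R, forall w, (\int[lambda]_y (q w y)%:E <= M%:E)%E].

Lemma mass_bounded_measurable q w : mass_bounded q -> measurable_fun setT (q w).
Proof. by case=> mq _ _; exact: (measurable_fun_pair2 w mq). Qed.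

Lemma measurable_affinity d (U : measurableType d) (q : U -> Y -> R) :
  measurable_fun setT (fun z : U * Y => q z.1 z.2) ->
  measurable_fun setT (fun u => affinity (q u)).
Proof.
move=> mq.
apply: (@measurable_fun_fubini_tonelli_F _ _ _ _ _ lambda
  (fun z => (wgeom (q z.1) z.2)%:E)) => [|z]; last by rewrite lee_fin wgeom_ge0.
apply/measurable_EFinP.
exact: (@measurable_wgeom _ _ (fun z : U * Y => q z.1) snd).
Qed.

Lemma mass_bounded_affinity q : mass_bounded q ->
  exists2 M : R, 0 <= M & forall w, (affinity (q w) <= M%:E)%E.
Proof.
move=> dq; have [mq q0 [M qM]] := dq; exists (`|M| + 1).
  by rewrite addr_ge0.
move=> w; apply: affinity_le => //; first exact: mass_bounded_measurable.
by rewrite (le_trans (qM w))// lee_fin ler_norm.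
Qed.

Lemma mean_affinity_ge0 q : (0 <= mean_affinity q)%E.
Proof. by apply: integral_ge0 => w _; exact: affinity_ge0. Qed.

Lemma mean_affinity_fin_num q : mass_bounded q -> mean_affinity q \is a fin_num.
Proof.
move=> dq; have [M M0 aM] := mass_bounded_affinity dq.
have [mq q0 _] := dq.
rewrite ge0_fin_numE ?mean_affinity_ge0//; apply: (@le_lt_trans _ _ M%:E); last exact: ltry.
rewrite -(integral_probability_cst P M%:E).
apply: ge0_le_integral => //.
- by move=> w _; exact: affinity_ge0.
- exact: measurable_affinity.
Qed.

(** For [r <= 1] one has [r <= r `^ b], so that the factor [r] may be moved inside
the power, where [r * q <= q'] applies. *)
Lemma affinity_scale (q q' : Y -> R) (r : R) : 0 < r <= 1 ->
  measurable_fun setT q -> measurable_fun setT q' -> (forall y, 0 <= q y) ->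
  (forall y, r * q y <= q' y) -> (r%:E * affinity q <= affinity q')%E.
Proof.
move=> r01 mq mq' q0 qq'; have /andP[r0 r1] := r01; have /andP[b0 b1] := b01.
have mt f : measurable_fun setT f -> measurable_fun setT (fun y => (wgeom f y)%:E).
  by move=> mf; apply/measurable_EFinP; exact: (@measurable_wgeom _ _ (fun=> f)).
rewrite /affinity -ge0_integralZl_EFin ?(ltW r0)//; first last.
- exact: mt.
- by move=> y _; rewrite lee_fin wgeom_ge0.
apply: ge0_le_integral => //.
- by move=> y _; rewrite -EFinM lee_fin mulr_ge0 ?wgeom_ge0// ltW.
- by apply: measurable_funeM; exact: mt.
- exact: mt.
move=> y _; rewrite -EFinM lee_fin /wgeom mulrA; have py := p_gt0 y.
apply: ler_wpM2r; first exact: ltW.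
have qp0 : 0 <= q y / p y by rewrite divr_ge0// ltW.
apply: (@le_trans _ _ (r `^ b * (q y / p y) `^ b)).
  by apply: ler_wpM2r; rewrite ?powR_ge0// ger1_powR// ltW.
rewrite -powRM ?(ltW r0)//; apply: ge0_ler_powR; rewrite ?nnegrE ?(ltW b0)//.
- by rewrite mulr_ge0// ltW.
- by rewrite divr_ge0 ?(ltW py)// (le_trans _ (qq' y))// mulr_ge0// ltW.
- by rewrite mulrA ler_wpM2r// invr_ge0 ltW.
Qed.

Lemma mean_affinity_scale q q' (r : R) : 0 < r <= 1 ->
  mass_bounded q -> mass_bounded q' -> (forall w y, r * q w y <= q' w y) ->
  (r%:E * mean_affinity q <= mean_affinity q')%E.
Proof.
move=> r01 dq dq' qq'; have /andP[r0 _] := r01.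
have [mq q0 _] := dq; have [mq' _ _] := dq'.
rewrite /mean_affinity -ge0_integralZl_EFin ?(ltW r0)//; first last.
- exact: measurable_affinity.
- by move=> w _; exact: affinity_ge0.
apply: ge0_le_integral => //.
- by move=> w _; rewrite mule_ge0 ?affinity_ge0// lee_fin ltW.
- by apply: measurable_funeM; exact: measurable_affinity.
- exact: measurable_affinity.
by move=> w _; apply: affinity_scale => //; exact: mass_bounded_measurable.
Qed.

Section mixture.
Context {dS} {S : measurableType dS} (mu : probability S R).
Variables (q : S -> T -> Y -> R) (lo up : T -> Y -> R).
Hypotheses (mq : measurable_fun setT (fun z : S * (T * Y) => q z.1 z.2.1 z.2.2)).
Hypotheses (lo_gt0 : forall w y, 0 < lo w y).
Hypotheses (q_bnd : forall s w y, lo w y <= q s w y <= up w y).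

Definition mixture w y : R := \int[mu]_s q s w y.

Let mqs w y : measurable_fun setT (fun s => q s w y).
Proof. exact: (measurable_fun_pair1 (w, y) mq). Qed.

Let q_ge0 s w y : 0 <= q s w y.
Proof. by have /andP[+ _] := q_bnd s w y; apply/le_trans/ltW. Qed.

Lemma integrable_mixture w y : mu.-integrable setT (fun s => (q s w y)%:E).
Proof.
apply: (@le_integrable _ _ _ _ _ _ _ (cst (up w y)%:E)) => //; last first.
- exact: finite_measure_integrable_cst.
- move=> s _ /=; rewrite lee_fin; have /andP[_ h] := q_bnd s w y.
  by rewrite !ger0_norm// (le_trans _ h).
- exact/measurable_EFinP.
Qed.

Lemma mixture_intE w y : (\int[mu]_s (q s w y)%:E = (mixture w y)%:E)%E.
Proof.
by rewrite /mixture fineK//; apply: integrable_fin_num; [|exact: integrable_mixture].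
Qed.

Lemma mixture_bnd w y : lo w y <= mixture w y <= up w y.
Proof.
rewrite -!lee_fin -mixture_intE -(integral_probability_cst mu (lo w y)%:E).
rewrite -(integral_probability_cst mu (up w y)%:E); apply/andP; split; apply: ge0_le_integral => //.
- by move=> s _; rewrite lee_fin ltW.
- exact/measurable_EFinP.
- by move=> s _; rewrite lee_fin; have /andP[] := q_bnd s w y.
- by move=> s _; rewrite lee_fin.
- exact/measurable_EFinP.
- by move=> s _; rewrite lee_fin; have /andP[] := q_bnd s w y.
Qed.

(** Jensen's inequality for the concave power [t `^ b]: integrate over [s] the
tangent line at the mean. *)
Lemma jensen_wgeom w y :
  (\int[mu]_s (wgeom (q s w) y)%:E <= (wgeom (mixture w) y)%:E)%E.
Proof.
have py := p_gt0 y; have /andP[b0 b1] := b01.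
have m0 : 0 < mixture w y.
  by have /andP[+ _] := mixture_bnd w y; exact: lt_le_trans.
have a0 : 0 < mixture w y / p y by exact: divr_gt0.
pose c := (mixture w y / p y) `^ b * p y.
have c0 : 0 <= c by rewrite mulr_ge0 ?powR_ge0// ltW.
pose u := c * b / mixture w y.
have u0 : 0 <= u by exact: divr_ge0 (mulr_ge0 c0 (ltW b0)) (ltW m0).
have v0 : 0 <= c * (1 - b) by rewrite mulr_ge0// subr_ge0 ltW.
(* [u * q s w y + c * (1 - b)] is [p y] times the tangent line at
   [mixture w y / p y], evaluated at [q s w y / p y]; the line being affine, its
   mean over [s] is its value at the point of tangency. *)
have -> : (wgeom (mixture w) y)%:E =
    (\int[mu]_s (u%:E * (q s w y)%:E + (c * (1 - b))%:E))%E.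
  rewrite ge0_integralD//.
  - rewrite ge0_integralZl_EFin//.
    + rewrite mixture_intE integral_probability_cst -EFinM -EFinD; congr EFin.
      by rewrite divfK ?gt_eqF// /wgeom -/c; ring.
    + by move=> s _; rewrite lee_fin.
    + exact/measurable_EFinP.
  - by move=> s _; rewrite -EFinM lee_fin mulr_ge0.
  - by apply: measurable_funeM; exact/measurable_EFinP.
apply: ge0_le_integral => //.
- by move=> s _; rewrite lee_fin wgeom_ge0.
- apply/measurable_EFinP.
  exact: (@measurable_wgeom _ _ (fun s => q s w) (fun=> y)).
- apply: emeasurable_funD => //.
  by apply: measurable_funeM; exact/measurable_EFinP.
move=> s _; rewrite -EFinM -EFinD lee_fin.
have := powR_tangent b01 a0 (divr_ge0 (q_ge0 s w y) (ltW py)).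
move=> /(ler_wpM2r (ltW py)) /le_trans; apply.
rewrite le_eqVlt; apply/orP; left; apply/eqP.
rewrite /u /c; field; rewrite !gt_eqF//.
Qed.

Lemma mass_bounded_mixture :
  (exists M : R, forall w, (\int[lambda]_y (up w y)%:E <= M%:E)%E) ->
  measurable_fun setT (fun z : T * Y => up z.1 z.2) ->
  mass_bounded mixture.
Proof.
move=> [M upM] mup.
have mm : measurable_fun setT (fun z : T * Y => mixture z.1 z.2).
  apply/measurable_EFinP.
  apply: (eq_measurable_fun (fun z : T * Y => \int[mu]_s (q s z.1 z.2)%:E)%E).
    by move=> z _ /=; rewrite mixture_intE.
  apply: (@measurable_fun_fubini_tonelli_G _ _ _ _ _ mu
    (fun z => (q z.1 z.2.1 z.2.2)%:E)) => [|z]; last by rewrite lee_fin.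
  exact/measurable_EFinP.
have m0 w y : 0 <= mixture w y.
  by have /andP[+ _] := mixture_bnd w y; apply/le_trans/ltW.
split => //; exists M => w; apply: le_trans (upM w).
apply: ge0_le_integral => //.
- by move=> y _; rewrite lee_fin.
- by apply/measurable_EFinP; exact: (measurable_fun_pair2 w mm).
- by apply/measurable_EFinP; exact: (measurable_fun_pair2 w mup).
- by move=> y _; rewrite lee_fin; have /andP[] := mixture_bnd w y.
Qed.

Let mST : measurable_fun setT (fun z : S * T => affinity (q z.1 z.2)).
Proof.
apply: (@measurable_affinity _ _ (fun z : S * T => q z.1 z.2)).
apply: (@measurableT_comp _ _ _ _ _ _ (fun z : S * (T * Y) => q z.1 z.2.1 z.2.2) _
  (fun z : (S * T) * Y => (z.1.1, (z.1.2, z.2)))) => //.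
apply: measurable_fun_pair => /=; first exact: measurableT_comp.
by apply: measurable_fun_pair => //=; exact: measurableT_comp.
Qed.

Lemma measurable_mean_affinity : measurable_fun setT (fun s => mean_affinity (q s)).
Proof.
apply: (@measurable_fun_fubini_tonelli_F _ _ _ _ _ P
  (fun z : S * T => affinity (q z.1 z.2))) => [|z]; last exact: affinity_ge0.
exact: mST.
Qed.

(** Jensen's inequality at each point, and Tonelli twice to bring the integral
over the mixing variable outside. *)
Lemma mean_affinity_mixture : measurable_fun setT (fun z : T * Y => mixture z.1 z.2) ->
  (\int[mu]_s mean_affinity (q s) <= mean_affinity mixture)%E.
Proof.
move=> mm.
rewrite [leLHS](@fubini_tonelli _ _ _ _ _ mu P (fun z : S * T => affinity (q z.1 z.2)))//; last first.
  by move=> z; exact: affinity_ge0.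
apply: ge0_le_integral => //.
- by move=> w _; apply: integral_ge0 => s _; exact: affinity_ge0.
- apply: (@measurable_fun_fubini_tonelli_G _ _ _ _ _ mu
    (fun z : S * T => affinity (q z.1 z.2))) => // z.
  exact: affinity_ge0.
- exact: measurable_affinity.
move=> w _ /=.
have msy : measurable_fun setT (fun z : S * Y => (wgeom (q z.1 w) z.2)%:E).
  apply/measurable_EFinP.
  apply: (@measurable_wgeom _ _ (fun z : S * Y => q z.1 w) snd) => //.
  apply: (@measurableT_comp _ _ _ _ _ _ (fun z : S * (T * Y) => q z.1 z.2.1 z.2.2) _
    (fun z : S * Y => (z.1, (w, z.2)))) => //.
  by apply: measurable_fun_pair => //; exact: measurable_fun_pair.
rewrite [leLHS](@fubini_tonelli _ _ _ _ _ mu lambda (fun z : S * Y => (wgeom (q z.1 w) z.2)%:E))//; last first.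
  by move=> z; rewrite lee_fin wgeom_ge0.
apply: ge0_le_integral => //.
- by move=> y _; apply: integral_ge0 => s _; rewrite lee_fin wgeom_ge0.
- apply: (@measurable_fun_fubini_tonelli_G _ _ _ _ _ mu
    (fun z : S * Y => (wgeom (q z.1 w) z.2)%:E)) => //.
  by move=> z; rewrite lee_fin wgeom_ge0.
- apply/measurable_EFinP; apply: (@measurable_wgeom _ _ (fun=> mixture w) id) => //.
  exact: (measurable_fun_pair2 w mm).
- by move=> y _; exact: jensen_wgeom.
Qed.

End mixture.
End average.
End affinity.

(** * Alpha-divergence risk as an affinity *)

Section risk.
Context {R : realType} {n : nat} (theta : Rvec R n) (sY alpha : R).
Hypotheses (sY_gt0 : 0 < sY) (alpha_lt1 : `|alpha| < 1).

Let p : Rvec R n -> R := mvnormal_pdf theta sY.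
Let b : R := (1 + alpha) / 2.
Let K : R := 4 / (1 - alpha ^+ 2).
Notation lambda := (lebesgue_Rvec n).

Lemma affinity_order_itv : 0 < b < 1.
Proof. by move: alpha_lt1; rewrite ltr_norml /b => /andP[h1 h2]; lra. Qed.

Lemma loss_scale_gt0 : 0 < K.
Proof.
rewrite /K divr_gt0// subr_gt0 -real_normK ?num_real// expr_lt1//.
Qed.

Let b01 := affinity_order_itv.
Let K_gt0 := loss_scale_gt0.
Let p_gt0 y : 0 < p y := mvnormal_pdf_gt0 theta y sY_gt0.
Let mp : measurable_fun setT p.
Proof. by apply: measurable_mvnormal_pdf. Qed.
Let ip : (\int[lambda]_y (p y)%:E = 1)%E := integral_mvnormal_pdf theta sY_gt0.

(** As [p] has mass one, [p - (q / p) `^ b * p] integrates to one minus the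
affinity. *)
Lemma alpha_lossE (q : Rvec R n -> R) (M : R) :
  measurable_fun setT q -> (forall y, 0 <= q y) ->
  (\int[lambda]_y (q y)%:E <= M%:E)%E ->
  alpha_loss alpha sY theta q = (K%:E * (1 - affinity lambda b p q))%E.
Proof.
move=> mq q0 qM.
have iP : lambda.-integrable setT (EFin \o p).
  apply/integrableP; split; first exact/measurable_EFinP.
  under eq_integral do rewrite /= ger0_norm ?ltW//.
  by rewrite ip ltry.
have mt : measurable_fun setT (wgeom b p q) by exact: (@measurable_wgeom _ _ _ _ _ mp _ _ (fun=> q)).
have iT : lambda.-integrable setT (EFin \o wgeom b p q).
  apply/integrableP; split; first exact/measurable_EFinP.
  under eq_integral do rewrite /= ger0_norm ?wgeom_ge0//.
  by apply: le_lt_trans (affinity_le b01 mp p_gt0 ip mq q0 qM) _; rewrite ltry.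
rewrite -ip /affinity -integralB// -integralZl//.
  apply: eq_integral => y _; rewrite /= -EFinB -EFinM; congr EFin.
  by rewrite /h_div /wgeom -/p -/K -/b; ring.
exact: integrableB.
Qed.

Context {dT : measure_display} {T : measurableType dT}.
Context (P : Rvec R n -> probability T R) (X : T -> Rvec R n).
Implicit Type q : Rvec R n -> Rvec R n -> R.

Lemma alpha_riskE q : mass_bounded lambda (fun w => q (X w)) ->
  alpha_risk P X alpha sY q theta =
  (K%:E * (1 - mean_affinity lambda b p (P theta) (fun w => q (X w))))%E.
Proof.
move=> dq; have [mq q0 [M qM]] := dq.
have [N N0 aN] := mass_bounded_affinity b01 mp p_gt0 ip dq.
have ma : measurable_fun setT (fun w => affinity lambda b p (q (X w))).
  exact: (@measurable_affinity _ _ _ _ _ _ mp p_gt0 _ _ (fun w => q (X w))).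
have iA : (P theta).-integrable setT (fun w => affinity lambda b p (q (X w))).
  apply: (@le_integrable _ _ _ _ _ _ _ (cst N%:E)) => //; last first.
  - exact: finite_measure_integrable_cst.
  - move=> w _ /=; rewrite gee0_abs ?ger0_norm//.
    exact: affinity_ge0.
have i1 : (P theta).-integrable setT (cst 1%E).
  exact: finite_measure_integrable_cst.
rewrite /alpha_risk.
under eq_integral => w _.
  rewrite (alpha_lossE (mass_bounded_measurable w dq) (q0 w) (qM w)).
  over.
rewrite integralZl//; last exact: integrableB.
rewrite integralB//; congr (_ * (_ - _))%E.
exact: integral_probability_cst.
Qed.

Lemma alpha_risk_le q q' :
  mass_bounded lambda (fun w => q (X w)) ->
  mass_bounded lambda (fun w => q' (X w)) ->
  (alpha_risk P X alpha sY q theta <= alpha_risk P X alpha sY q' theta)%E =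
  (mean_affinity lambda b p (P theta) (fun w => q' (X w)) <=
   mean_affinity lambda b p (P theta) (fun w => q (X w)))%E.
Proof.
move=> dq dq'; rewrite !alpha_riskE//.
have := mean_affinity_fin_num b01 mp p_gt0 ip (P theta) dq.
have := mean_affinity_fin_num b01 mp p_gt0 ip (P theta) dq'.
case: (mean_affinity _ _ _ _ (fun w => q' (X w))) => // a' _.
case: (mean_affinity _ _ _ _ (fun w => q (X w))) => // a _.
by rewrite -!EFinB -!EFinM !lee_fin ler_pM2l// lerD2l lerN2.
Qed.

Lemma alpha_risk_lt q q' :
  mass_bounded lambda (fun w => q (X w)) ->
  mass_bounded lambda (fun w => q' (X w)) ->
  (alpha_risk P X alpha sY q theta < alpha_risk P X alpha sY q' theta)%E =
  (mean_affinity lambda b p (P theta) (fun w => q' (X w)) <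
   mean_affinity lambda b p (P theta) (fun w => q (X w)))%E.
Proof.
move=> dq dq'; rewrite !alpha_riskE//.
have := mean_affinity_fin_num b01 mp p_gt0 ip (P theta) dq.
have := mean_affinity_fin_num b01 mp p_gt0 ip (P theta) dq'.
case: (mean_affinity _ _ _ _ (fun w => q' (X w))) => // a' _.
case: (mean_affinity _ _ _ _ (fun w => q (X w))) => // a _.
by rewrite -!EFinB -!EFinM !lte_fin ltr_pM2l// ltrD2l ltrN2.
Qed.

End risk.

(** The risk is a decreasing affine function of the mean affinity, and finite, so
that domination is the reverse comparison of the mean affinities. *)
Lemma dominates_affinity (R : realType) n (sY alpha : R) (C : set (Rvec R n))
    (dT : measure_display) (T : measurableType dT) (P : Rvec R n -> probability T R)
    (X : T -> Rvec R n) (q q' : Rvec R n -> Rvec R n -> R) :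
  let A theta r := mean_affinity (lebesgue_Rvec n) ((1 + alpha) / 2)
    (mvnormal_pdf theta sY) (P theta) (fun w => r (X w)) in
  0 < sY -> `|alpha| < 1 ->
  mass_bounded (lebesgue_Rvec n) (fun w => q (X w)) ->
  mass_bounded (lebesgue_Rvec n) (fun w => q' (X w)) ->
  dominates P X C alpha sY q q' <->
  (forall theta, C theta -> (A theta q' <= A theta q)%E) /\
  (exists2 theta, C theta & (A theta q' < A theta q)%E).
Proof.
move=> A sY0 al1 dq dq'.
have le theta := alpha_risk_le theta sY0 al1 P dq dq'.
have lt theta := alpha_risk_lt theta sY0 al1 P dq dq'.
split=> -[h [theta Ct htheta]]; split.
- move=> t /h ht; rewrite -(le t); exact: ht.
- by exists theta; [exact: Ct|rewrite -(lt theta)].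
- move=> t /h ht; rewrite (le t); exact: ht.
- by exists theta; [exact: Ct|rewrite (lt theta)].
Qed.

(** * Mass of a distribution function on short intervals *)

Section stieltjes.
Context {R : realType}.
Implicit Types (F : cumulativeBounded (0 : R) (1 : R)) (k : R).

Lemma lebesgue_stieltjes_itvoc F (a e : R) : a <= e ->
  lebesgue_stieltjes_measure F `]a, e]%classic = (F e - F a)%:E.
Proof.
move=> ae; rewrite /lebesgue_stieltjes_measure /measure_extension.
by rewrite measurable_mu_extE/= ?wlength_itv_bnd//; exact: is_ocitv.
Qed.

Lemma lebesgue_stieltjes_full F k : 1 <= k -> F 1 = 0 -> F k = 1 ->
  lebesgue_stieltjes_measure F `[1, k]%classic = 1%E.
Proof.
move=> k1 F1 Fk; apply/eqP; rewrite eq_le probability_le1//=.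
rewrite -[leLHS](_ : lebesgue_stieltjes_measure F `]1, k]%classic = 1%E).
  by apply: le_measure; rewrite ?inE//; apply: subset_itvr; rewrite bnd_simp.
by rewrite lebesgue_stieltjes_itvoc// F1 Fk subr0.
Qed.

(** The intervals [`]x, e]] with [x < c] have mass [F e - F x >= F e - F a] and
decrease to [`[c, e]] when [x] increases to [c]. Stated with [F a] as a bound
of [F] on the left of [c], this covers a possible atom at [c]. *)
Lemma lebesgue_stieltjes_itvcc_ge F (a c e : R) : c <= e ->
  (forall x, x < c -> F x <= F a) ->
  ((F e - F a)%:E <= lebesgue_stieltjes_measure F `[c, e]%classic)%E.
Proof.
move=> ce Fa.
pose I n : set R := `]c - n.+1%:R^-1, e]%classic.
have c_lt n : c - n.+1%:R^-1 < c by rewrite ltrBlDr ltrDl invr_gt0.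
have IE : `[c, e]%classic = \bigcap_n I n.
  apply/seteqP; split=> x /=.
    rewrite in_itv/= => /andP[cx xe] n _; rewrite /I /= in_itv/= xe andbT.
    exact: lt_le_trans cx.
  move=> xI; have := xI 0%N Logic.I; rewrite /I /= in_itv/= => /andP[_ xe].
  rewrite in_itv/= xe andbT leNgt; apply/negP => xc.
  have [m] := ltr_add_invr xc.
  have := xI m Logic.I; rewrite /I /= in_itv/= => /andP[+ _].
  by rewrite ltrBlDr => /lt_trans h /h; rewrite ltxx.
have mI n : measurable (I n) by exact: measurable_itv.
have cv : lebesgue_stieltjes_measure F \o I @ \oo -->
    lebesgue_stieltjes_measure F `[c, e]%classic.
  rewrite IE; apply: nonincreasing_cvg_mu => //.
  - apply: (@le_lt_trans _ _ 1%E); last exact: ltry.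
    by have := probability_le1 (lebesgue_stieltjes_measure F) (mI 0%N).
  - by rewrite -IE; exact: measurable_itv.
  - move=> i j ij; apply/subsetPset/subset_itvr; rewrite bnd_simp.
    by rewrite lerD2l lerN2 lef_pV2 ?posrE// ler_nat.
rewrite -(cvg_lim _ cv)//; apply: lime_ge; first by apply/cvg_ex; eexists; exact: cv.
apply: nearW => m /=; rewrite lebesgue_stieltjes_itvoc ?(le_trans (ltW (c_lt m)))//.
by rewrite lee_fin lerD2l lerN2 Fa.
Qed.

(** By right continuity there is [a > 1] with [F a < F z]. The infimum [c] of the
points where [F] exceeds [F a] lies between [a] and [z]; on its left [F] is at
most [F a], and on its right [F] is greater. The bound [a > 1] keeps [c] away
from [1] even when [1] itself is in the support. *)
Lemma interior_support_point F k : F 1 = 0 -> (exists2 z, z < k & 0 < F z) ->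
  exists2 c, 1 < c < k & forall e, c < e ->
    (0 < lebesgue_stieltjes_measure F `[c, e]%classic)%E.
Proof.
move=> F1 [z zk Fz].
have ndF : {homo F : x y / x <= y} by exact: cumulative_is_nondecreasing.
have [d /= Fd] := nondecreasing_right_continuousP 1 F (divr_gt0 Fz (ltr0Sn R 1)).
pose a := 1 + d%:num.
have Fa : F a < F z by rewrite (le_lt_trans Fd)// F1 add0r ltr_pdivrMr// mulr_natr mulr2n ltrDl.
pose E := [set c | F a < F c].
have Ez : E z by [].
have lbE : lbound E a.
  by move=> c /= Fc; rewrite leNgt; apply/negP => /ltW /ndF; rewrite leNgt Fc.
have ac : a <= inf E by apply: lb_le_inf => //; exists z.
exists (inf E).
  rewrite (lt_le_trans _ ac) ?ltrDl//=.
  by apply: le_lt_trans zk; apply: ge_inf => //; exists a.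
move=> e ce; have [x Ex xe] := inf_lt (ex_intro _ z Ez : E !=set0) ce.
have Fe : F a < F e by apply: lt_le_trans Ex _; apply/ndF/ltW.
apply: lt_le_trans (lebesgue_stieltjes_itvcc_ge (a := a) (ltW ce) _).
  by rewrite lte_fin subr_gt0.
move=> x' x'c; rewrite leNgt; apply/negP => Ex'.
by have : inf E <= x' by [apply: ge_inf => //; exists a]; rewrite leNgt x'c.
Qed.

End stieltjes.

(** * Scale mixtures of plug-in densities *)

Section scale_mixture.
Context {R : realType}.

Lemma exprM_near1 n (u v : R) : v < u ->
  exists2 r0 : R, 0 < r0 < 1 & forall r : R, r0 < r <= 1 -> v < r ^+ n * u.
Proof.
move=> vu.
have cf : (r ^+ n * u) @[r --> (1 : R)] --> u.
  have {2}-> : u = 1 ^+ n * u by rewrite expr1n mul1r.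
  by apply: cvgMl; exact: exprn_continuous.
have [e /= e0 eP] := cvgr_gt _ cf _ vu.
exists (Num.max 2^-1 (1 - e)).
  rewrite lt_max gt_max invr_gt0 ltr0n/= invf_lt1 ?ltr1n//=.
  by rewrite ltrBlDr ltrDl.
move=> r; rewrite gt_max => /andP[/andP[_ er] r1]; apply: eP.
by rewrite /= ger0_norm ?subr_ge0// ltrBlDr addrC -ltrBlDr.
Qed.

(** Integrating over [[1, k]] against a probability carried by this interval is
integrating over the line after clamping the variable to it. The clamped
family of densities satisfies uniform bounds for every value of the variable. *)
Definition clamp (k z : R) : R := Num.max 1 (Num.min z k).

Lemma clamp_itv k z : 1 <= k -> 1 <= clamp k z <= k.
Proof. by move=> k1; rewrite le_max lexx/= ge_max k1 ge_min lexx orbT. Qed.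

Lemma clamp_id k z : 1 <= z <= k -> clamp k z = z.
Proof. by move=> /andP[z1 zk]; rewrite /clamp min_l// max_r. Qed.

Lemma measurable_clamp k : measurable_fun [set: R] (clamp k).
Proof. by apply: measurable_maxr => //; exact: measurable_minr. Qed.

Lemma Rintegral_full d (S : measurableType d) (mu : probability S R) (D : set S)
    (f g : S -> R) : measurable D -> mu D = 1%E ->
  measurable_fun setT g -> (forall s, 0 <= g s) -> {in D, f =1 g} ->
  \int[mu]_(s in D) f s = \int[mu]_s g s.
Proof.
move=> mD D1 mg g0 fg; congr fine.
rewrite [RHS](@ge0_negligible_integral _ _ _ _ _ (~` D))//.
- rewrite setTD setCK; apply: eq_integral => s sD; by rewrite fg.
- exact: measurableC.
- exact/measurable_EFinP.
- by move=> s _; rewrite lee_fin.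
- transitivity (1 - mu D)%E; first exact: probability_setC.
  by rewrite D1 subee.
Qed.

Context {n : nat} (est : {mfun Rvec R n >-> Rvec R n}).
Context {dT : measure_display} {T : measurableType dT} (X : {mfun T >-> Rvec R n}).
Variable sY : R.
Hypothesis sY_gt0 : 0 < sY.

Notation lambda := (lebesgue_Rvec n).
Notation plugin c := (fun w y => plugin_density est sY c (X w) y).

Lemma mass_bounded_plugin c : 0 < c -> mass_bounded lambda (plugin c).
Proof.
move=> c0; have cs0 : 0 < c * sY by exact: mulr_gt0.
split=> [|w y|]; first last.
- by exists 1 => w; rewrite integral_mvnormal_pdf.
- by rewrite ltW// mvnormal_pdf_gt0.
apply: (@measurable_mvnormal_pdf _ _ _ _ (fun z : T * Rvec R n => est (X z.1)) snd) => //.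
by apply: measurableT_comp => //; exact: measurableT_comp.
Qed.

Lemma plugin_scale_le c c' w y : 0 < c <= c' ->
  (c / c') ^+ n * plugin c w y <= plugin c' w y.
Proof. exact: scaled_mvnormal_pdf_le. Qed.

Variables (k : R) (F : cumulativeBounded (0 : R) (1 : R)).
Hypotheses (k_gt1 : 1 < k) (F1 : F 1 = 0) (Fk : F k = 1).

Let muF : probability (measurableTypeR R) R := lebesgue_stieltjes_measure F.

Let lo w y := (1 / k) ^+ n * plugin 1 w y.
Let up w y := k ^+ n * plugin k w y.

Let k_gt0 : 0 < k := lt_trans ltr01 k_gt1.

Let lo_gt0 w y : 0 < lo w y.
Proof.
by rewrite mulr_gt0 ?exprn_gt0 ?divr_gt0// mvnormal_pdf_gt0// mul1r.
Qed.

Let plugin_clamp_bnd z w y : lo w y <= plugin (clamp k z) w y <= up w y.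
Proof.
have /andP[c1 ck] := clamp_itv z (ltW k_gt1); set c := clamp k z in c1 ck *.
have c0 : 0 < c by exact: lt_le_trans c1.
apply/andP; split.
  apply: (@le_trans _ _ ((1 / c) ^+ n * plugin 1 w y)).
    rewrite ler_wpM2r//; first by rewrite ltW// mvnormal_pdf_gt0// mul1r.
    by rewrite lerXn2r ?nnegrE ?divr_ge0 ?(ltW k_gt0) ?(ltW c0)// !mul1r lef_pV2.
  by apply: plugin_scale_le; rewrite ltr01.
apply: (@le_trans _ _ ((k / c) ^+ n * plugin k w y)).
  have := @plugin_scale_le c k w y; rewrite c0 ck => /(_ isT).
  move=> /(ler_wpM2l (exprn_ge0 n (divr_ge0 (ltW k_gt0) (ltW c0)))).
  rewrite mulrA -exprMn (_ : k / c * (c / k) = 1) ?expr1n ?mul1r//.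
  by field; rewrite !gt_eqF.
rewrite ler_wpM2r//; first by rewrite ltW// mvnormal_pdf_gt0// mulr_gt0.
rewrite lerXn2r ?nnegrE ?divr_ge0 ?(ltW k_gt0) ?(ltW c0)//.
by rewrite ler_pdivrMr// ler_peMr// ltW.
Qed.

Let measurable_plugin_clamp : measurable_fun setT
  (fun z : measurableTypeR R * (T * Rvec R n) => plugin (clamp k z.1) z.2.1 z.2.2).
Proof.
apply: (@measurable_mvnormal_pdf _ _ _ _ (fun z => est (X z.2.1)) (fun z => z.2.2)
  (fun z : measurableTypeR R * (T * Rvec R n) => clamp k z.1 * sY)).
- apply: measurableT_comp => //; apply: measurableT_comp => //.
  exact: measurableT_comp.
- apply: measurable_funM => //; apply: measurableT_comp => //.
  exact: measurable_clamp.
- exact: measurableT_comp.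
Qed.

Lemma mixture_densityE w y : mixture_density est sY k F (X w) y =
  mixture muF (fun z => plugin (clamp k z)) w y.
Proof.
apply: Rintegral_full.
- exact: measurable_itv.
- exact: (lebesgue_stieltjes_full (ltW k_gt1)).
- exact: (measurable_fun_pair1 (w, y) measurable_plugin_clamp).
- by move=> z; have /andP[+ _] := plugin_clamp_bnd z w y; apply/le_trans/ltW.
- by move=> z; rewrite inE/= in_itv/= => zk; rewrite clamp_id.
Qed.

Lemma mass_bounded_mixture_density :
  mass_bounded lambda (fun w => mixture_density est sY k F (X w)).
Proof.
rewrite (_ : (fun w => _) = mixture muF (fun z => plugin (clamp k z))); last first.
  by apply/funext => w; apply/funext => y; exact: mixture_densityE.
have [mk kge _] := mass_bounded_plugin k_gt0.
apply: (@mass_bounded_mixture _ _ _ _ _ _ _ _ muF (fun z => plugin (clamp k z))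
  lo up measurable_plugin_clamp lo_gt0 plugin_clamp_bnd).
  exists (k ^+ n) => w; under eq_integral do rewrite EFinM.
  rewrite ge0_integralZl_EFin ?exprn_ge0 ?(ltW k_gt0)//.
  - by rewrite integral_mvnormal_pdf ?mulr_gt0// mule1.
  - by move=> y _; rewrite lee_fin.
  - apply/measurable_EFinP; exact: (measurable_fun_pair2 w mk).
exact: measurable_funM.
Qed.

Section affinity_bounds.
Variables (P : probability T R) (b : R) (p : Rvec R n -> R).
Hypotheses (b01 : 0 < b < 1) (mp : measurable_fun setT p).
Hypotheses (p_gt0 : forall y, 0 < p y) (ip : (\int[lambda]_y (p y)%:E = 1)%E).

Notation A := (mean_affinity lambda b p P).

Lemma plugin_affinity_scale c c' : 0 < c <= c' ->
  (((c / c') ^+ n)%:E * A (plugin c) <= A (plugin c'))%E.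
Proof.
move=> /andP[c0 cc']; have c'0 : 0 < c' by exact: lt_le_trans cc'.
apply: mean_affinity_scale => //; try exact: mass_bounded_plugin.
  rewrite exprn_gt0 ?divr_gt0//= exprn_ile1 ?divr_ge0 ?(ltW c0) ?(ltW c'0)//.
  by rewrite ler_pdivrMr// mul1r.
by move=> w y; apply: plugin_scale_le; rewrite c0.
Qed.

(** Lower semicontinuity of the mean affinity from the right of [c]: the loss
[(c / c') ^+ n] is arbitrarily close to one. *)
Lemma plugin_affinity_near c (v : R) : 0 < c -> (v%:E < A (plugin c))%E ->
  exists2 r0 : R, 0 < r0 < 1 &
    forall c', c <= c' -> r0 < c / c' -> (v%:E < A (plugin c'))%E.
Proof.
move=> c0; have := mean_affinity_fin_num b01 mp p_gt0 ip P (mass_bounded_plugin c0).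
case E : (A _) => [u| |]// _; rewrite lte_fin => /(exprM_near1 n)[r0 r01 r0P].
exists r0 => // c' cc' r0c; have c'0 : 0 < c' by exact: lt_le_trans cc'.
have := @plugin_affinity_scale c c'; rewrite c0 cc' E => /(_ isT).
apply: lt_le_trans; rewrite -EFinM lte_fin r0P// r0c/=.
by rewrite ler_pdivrMr// mul1r.
Qed.

Lemma mixture_affinity_ge :
  (\int[muF]_z A (plugin (clamp k z)) <=
   A (fun w => mixture_density est sY k F (X w)))%E.
Proof.
rewrite (_ : (fun w => mixture_density _ _ _ _ _) =
    mixture muF (fun z => plugin (clamp k z))); last first.
  by apply/funext => w; apply/funext => y; exact: mixture_densityE.
apply: (@mean_affinity_mixture _ _ _ _ _ _ b01 mp p_gt0 _ _ P _ _ muF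
  (fun z => plugin (clamp k z)) lo up measurable_plugin_clamp lo_gt0 plugin_clamp_bnd).
have [+ _ _] := mass_bounded_mixture_density.
by apply: eq_measurable_fun => z _; exact: mixture_densityE.
Qed.

Hypothesis Age : forall c, 1 < c < k -> (A (plugin 1) <= A (plugin c))%E.

(** The assumption [Age] covers the scales below [k] only, while the mixing
distribution may have an atom at [k]. The comparison extends to [k] because
[(x / k) ^+ n * A (plugin 1) <= (x / k) ^+ n * A (plugin x) <= A (plugin k)]
for the scales [x < k] close to [k]. *)
Lemma plugin_affinity_ge_clamp z : (A (plugin 1) <= A (plugin (clamp k z)))%E.
Proof.
have /andP[] := clamp_itv z (ltW k_gt1); set c := clamp k z.
rewrite le_eqVlt => /predU1P[<- //|c1]; rewrite le_eqVlt => /predU1P[->|ck]; last first.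
  by apply: Age; rewrite c1.
rewrite leNgt; apply/negP.
have := mean_affinity_fin_num b01 mp p_gt0 ip P (mass_bounded_plugin k_gt0).
case E : (A (plugin k)) => [v| |]// _ Av.
have := mean_affinity_fin_num b01 mp p_gt0 ip P (mass_bounded_plugin ltr01).
case E1 : (A (plugin 1)) => [u| |]// _; move: Av; rewrite E1 lte_fin.
move=> /(exprM_near1 n)[r0 /andP[r00 r01] r0P].
(* The two midpoints place [x] inside ]1, k[ and the ratio [x / k] inside ]r0, 1[. *)
pose x := Num.max ((1 + k) / 2) ((r0 + 1) / 2 * k).
have x1 : 1 < x.
  rewrite lt_max; apply/orP; left; exact: (midf_lt k_gt1).1.
have xk : x < k.
  rewrite gt_max; apply/andP; split; first exact: (midf_lt k_gt1).2.
  by rewrite gtr_pMl// (midf_lt r01).2.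
have := @plugin_affinity_scale x k; rewrite (lt_trans ltr01 x1) (ltW xk) => /(_ isT).
rewrite E leNgt => /negP; apply.
have xk0 : 0 <= (x / k) ^+ n.
  by rewrite exprn_ge0 ?divr_ge0 ?(ltW k_gt0)// ltW// (lt_trans ltr01 x1).
apply: (@lt_le_trans _ _ (((x / k) ^+ n)%:E * A (plugin 1)))%E.
  rewrite E1 -EFinM lte_fin r0P//; apply/andP; split.
    rewrite ltr_pdivlMr// lt_max; apply/orP; right.
    by rewrite ltr_pM2r// (midf_lt r01).1.
  by rewrite ler_pdivrMr// mul1r ltW.
by apply: lee_wpmul2l; [rewrite lee_fin|apply: Age; rewrite x1 xk].
Qed.

Lemma mixture_affinity_ge_plugin :
  (A (plugin 1) <= A (fun w => mixture_density est sY k F (X w)))%E.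
Proof.
apply: le_trans mixture_affinity_ge.
have A0 q : (0 <= A q)%E by exact: mean_affinity_ge0.
have A1 := integral_probability_cst muF (A (plugin 1)).
apply: (@le_trans _ _ (\int[muF]_z A (plugin 1))%E); first by rewrite A1.
apply: ge0_le_integral; first exact: measurableT.
- by move=> z _; exact: A0.
- exact: measurable_cst.
- exact: (@measurable_mean_affinity _ _ _ _ _ _ mp p_gt0 _ _ P _ _
    (fun z => plugin (clamp k z)) measurable_plugin_clamp).
- by move=> z _; exact: plugin_affinity_ge_clamp.
Qed.

(** A strict gain at the scale [c] persists, up to a smaller gain [m - u > 0], on
an interval [[c, e]] on the right of [c], which has positive mass. *)
Lemma mixture_affinity_gt_plugin c : 1 < c < k ->
  (forall e : R, c < e -> (0 < muF `[c, e]%classic)%E) ->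
  (A (plugin 1) < A (plugin c))%E ->
  (A (plugin 1) < A (fun w => mixture_density est sY k F (X w)))%E.
Proof.
move=> /andP[c1 ck] cF; have c0 : 0 < c by exact: lt_trans c1.
have A0 q : (0 <= A q)%E by exact: mean_affinity_ge0.
have := mean_affinity_fin_num b01 mp p_gt0 ip P (mass_bounded_plugin ltr01).
have := mean_affinity_fin_num b01 mp p_gt0 ip P (mass_bounded_plugin c0).
case Ec : (A (plugin c)) => [v| |]// _.
case E1 : (A (plugin 1)) => [u| |]// _; rewrite lte_fin => uv.
pose m := (u + v) / 2.
have um : u < m := (midf_lt uv).1.
have : (m%:E < A (plugin c))%E by rewrite Ec lte_fin (midf_lt uv).2.
move=> /(plugin_affinity_near c0)[r0 /andP[r00 r01] r0P].
(* For [z <= e] the ratio [c / z] is at least [(r0 + 1) / 2 > r0]. *)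
pose e := Num.min k (c / ((r0 + 1) / 2)).
have r1gt0 : 0 < (r0 + 1) / 2 := lt_trans r00 (midf_lt r01).1.
have ce : c < e.
  by rewrite lt_min ck/= ltr_pdivlMr// gtr_pMr// (midf_lt r01).2.
have /cF cF0 := ce.
have me z : z \in `[c, e] -> (m%:E <= A (plugin (clamp k z)))%E.
  rewrite in_itv/= => /andP[cz ze]; have z0 : 0 < z by exact: lt_le_trans cz.
  move: ze; rewrite le_min => /andP[zk zc].
  rewrite clamp_id ?zk ?andbT; last by rewrite ltW// (lt_le_trans c1).
  apply/ltW/r0P => //; apply: (@lt_le_trans _ _ ((r0 + 1) / 2)); first exact: (midf_lt r01).1.
  by rewrite ler_pdivlMr// mulrC -ler_pdivlMr.
apply: lt_le_trans mixture_affinity_ge.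
have u0 : 0 <= u by rewrite -lee_fin -E1.
have mI : measurable (`[c, e]%classic : set (measurableTypeR R)) by exact: measurable_itv.
apply: (@lt_le_trans _ _ (\int[muF]_z (u%:E + ((m - u) * \1_`[c, e] z)%:E))%E).
  rewrite ge0_integralD//; first last.
  - by apply/measurable_EFinP; apply: measurable_funM.
  - by move=> z _; rewrite lee_fin mulr_ge0// subr_ge0 ltW.
  rewrite (integral_probability_cst muF); under eq_integral do rewrite EFinM.
  rewrite ge0_integralZl_EFin//; last 2 first.
  - exact/measurable_EFinP.
  - by rewrite subr_ge0 ltW.
  rewrite integral_indic// setIT lteDl// mule_gt0// lte_fin subr_gt0//.
apply: ge0_le_integral; first exact: measurableT.
- by move=> z _; rewrite -EFinD lee_fin addr_ge0// mulr_ge0// subr_ge0 ltW.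
- by apply: emeasurable_funD => //; apply/measurable_EFinP; exact: measurable_funM.
- exact: (@measurable_mean_affinity _ _ _ _ _ _ mp p_gt0 _ _ P _ _
    (fun z => plugin (clamp k z)) measurable_plugin_clamp).
move=> z _; rewrite indicE; case: (boolP (z \in _)) => [|_].
  by rewrite inE => zce; rewrite mulr1 -EFinD addrC subrK; exact: me.
by rewrite mulr0 adde0 -E1; exact: plugin_affinity_ge_clamp.
Qed.

End affinity_bounds.
End scale_mixture.

(** * Domination by the mixture *)

Theorem lemma4 (R : realType) (d : nat) (sX sY alpha k : R)
    (C : set (Rvec R d))
    (dT : measure_display) (T : measurableType dT)
    (P : Rvec R d -> probability T R)
    (X Y : {mfun T >-> Rvec R d})
    (est : {mfun Rvec R d >-> Rvec R d})
    (F : cumulativeBounded (0 : R) (1 : R))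
    (sX_gt0 : 0 < sX) (sY_gt0 : 0 < sY) (alpha_lt1 : `|alpha| < 1)
    (X_normal : forall theta, C theta -> forall A, measurable A ->
       distribution (P theta) X A = mvnormal theta sX A)
    (Y_normal : forall theta, C theta -> forall A, measurable A ->
       distribution (P theta) Y A = mvnormal theta sY A)
    (XY_indep : forall theta, C theta -> independent_RV2 (P theta) X Y)
    (est_nondeg : non_degenerate P X C est)
    (eps_gt0 : (0 < ereal_inf
       [set \int[P theta]_w
              (let Z := sqdist (est (X w)) theta / sY ^+ 2 in
               Z * expR (- ((1 - alpha ^+ 2) * Z / 8)))%:E | theta in C])%E)
    (dom : forall c, 1 < c < k ->
       dominates P X C alpha sY (plugin_density est sY c)
                                (plugin_density est sY 1))
    (F1 : F 1 = 0) (Fk : F k = 1)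
    (F_not_dirac_k : exists2 z, z < k & 0 < F z) :
  dominates P X C alpha sY (mixture_density est sY k F)
                           (plugin_density est sY 1).
Proof.
have k_gt1 : 1 < k.
  rewrite ltNge; apply/negP => k1.
  have : F k <= F 1 by exact: cumulative_is_nondecreasing.
  by rewrite F1 Fk ler10.
have dplug c : 0 < c -> mass_bounded (lebesgue_Rvec d)
    (fun w => plugin_density est sY c (X w)).
  exact: mass_bounded_plugin.
have c_gt0 c : 1 < c < k -> 0 < c by case/andP => + _; exact: lt_trans.
have dmix := mass_bounded_mixture_density est X sY_gt0 k_gt1 F1 Fk.
have b01 := affinity_order_itv alpha_lt1.
have mp theta : measurable_fun setT (mvnormal_pdf (R := R) (n := d) theta sY).
  exact: measurable_mvnormal_pdf.
have p_gt0 theta y : 0 < mvnormal_pdf (R := R) (n := d) theta sY y.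
  exact: mvnormal_pdf_gt0.
have ip theta := integral_mvnormal_pdf (R := R) (n := d) theta sY_gt0.
have dom_affinity c (ck : 1 < c < k) := (dominates_affinity C P sY_gt0 alpha_lt1
  (dplug c (c_gt0 c ck)) (dplug 1 ltr01)).1 (dom c ck).
have Age theta (Ct : C theta) c (ck : 1 < c < k) :=
  (dom_affinity c ck).1 theta Ct.
have [c ck cF] := interior_support_point F1 F_not_dirac_k.
have [_ [theta Ct Alt]] := dom_affinity c ck.
apply/(dominates_affinity C P sY_gt0 alpha_lt1 dmix (dplug 1 ltr01)); split.
  move=> t Ct'; exact: (mixture_affinity_ge_plugin sY_gt0 k_gt1 F1 Fk b01 (mp t) (p_gt0 t)
    (ip t) (Age t Ct')).
exists theta; first exact: Ct.
exact: (mixture_affinity_gt_plugin sY_gt0 k_gt1 F1 Fk b01 (mp theta) (p_gt0 theta)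
  (ip theta) (Age theta Ct) ck cF Alt).
Qed.
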